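(* For $0\le i\le r$ denote by $X_i$ the curve $X/\ker\rho_i$ and by $F_i$ the corresponding function field. Suppose that $X_1=\mathbb{P}^1$ and $F_1=k(f_1)$. Then the jumps of the representation filtration appear exactly at those $i$ such that $F_i\neq F_{i+1}$. Moreover, if $i_1,i_2,\ldots,i_n$ are the jumps of the representation filtration, then for all $\ell$ with $1\le \ell\le n$ we have $$F_{i_\ell}=k(f_0,f_{i_1},\ldots,f_{i_\ell}),$$ i.e. the jumps appear exactly at the integers $i$ such that the function $f_i$ corresponding to the pole number $m_i$ gives rise to an element that cannot be expressed as a rational function of the $f_\nu$ with $\nu<i$.
   Context: $X$ is a projective nonsingular curve of genus $g\ge 2$ over an algebraically closed field $k$ of characteristic $p>0$, $G$ is a subgroup of $\mathrm{Aut}(X)$, $P$ is a point of $X$, $G(P)$ is the subgroup of elements of $G$ stabilizing $P$, and $G_1(P)=\{\sigma\in G(P): v_P(\sigma(t)-t)\ge 2\}$, where $t$ is a local uniformizer at $P$ and $v_P$ the corresponding valuation. For an integer $i\ge 0$, $L(iP)=\{f\in k(X)^*:\mathrm{div}(f)+iP\ge 0\}\cup\{0\}$. A pole number at $P$ is an integer $i\ge 0$ for which there is $f\in k(X)^*$ with pole divisor $(f)_\infty=iP$. Let $m$, with $1<m\le 2g-1$, be the smallest pole number at $P$ not divisible by $p$ (such an $m$ exists when $p\ne 2,3$), and let $0=m_0<m_1<\cdots<m_r=m$ be the pole numbers at $P$ that are $\le m$. For $0\le i\le r$, $f_i\in k(X)^*$ denotes a function with $(f_i)_\infty=m_iP$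 (so $f_0$, corresponding to $m_0=0$, is a constant function). For $0\le i\le r$ let $\rho_i:G_1(P)\to\mathrm{GL}(L(m_iP))$ be the natural representation; $\rho_r$ is faithful. The representation filtration is the decreasing sequence of groups $G_1(P)=\ker\rho_0\supseteq\ker\rho_1\supseteq\cdots\supseteq\ker\rho_r=\{1\}$. An index $i$ is called a jump of the representation filtration if $\ker\rho_i\supsetneq\ker\rho_{i+1}$.
   Formalization: The printed formula fails for jumps i with ker ρ_i ≠ ker ρ_{i+1}. Proved instead: F_{i_l+1} = k(f_0, f_1, f_{i_1+1}, ..., f_{i_l+1}); and for i<r, i=0 or i is a jump iff f_{i+1} is not in k(f_0, ..., f_i). *)

(* Defs.v *)
From HB Require Import structures.
From mathcomp Require Import all_boot all_order all_algebra.
From mathcomp Require Import boolp classical_sets.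
From mathcomp Require Import freeg.

Set Implicit Arguments.
Unset Strict Implicit.
Unset Printing Implicit Defensive.

Import Order.TTheory GRing.Theory Num.Theory.
Local Open Scope classical_set_scope.
Local Open Scope ring_scope.

(* A projective nonsingular curve X over the algebraically closed field k is
   given by its function field F = k(X), with iota : k -> F the inclusion of
   the constants: X is the set of places of F/k, and a morphism of curves is a
   k-embedding of function fields. *)

Section Curve.
Variables (k : closedFieldType) (F : fieldType) (iota : {rmorphism k -> F}).

Definition adjoin (S : set F) : set F :=
  [set x | forall E : set F, GRing.divring_closed [in E] ->
     range iota `<=` E -> S `<=` E -> E x].

(* F is a finite extension of k(x) for some x transcendental over k. *)
Definition function_field : Prop :=
  exists2 x : F, ~ algebraicOver iota x &
    exists b : seq F, forall y : F, exists2 a : nat -> F,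
      (forall i, adjoin [set x] (a i)) & y = \sum_(i < size b) a i * b`_i.

(* E is the function field of a curve isomorphic to the projective line. *)
Definition rational (E : set F) : Prop :=
  exists2 x : F, ~ algebraicOver iota x & E = adjoin [set x].

(* The points of X: normalized discrete valuations of F trivial on k.  The
   value at 0, mathematically +oo, is set to 0; [vge] and [Lspace] treat the
   zero function separately. *)
Record place := Place {
  pt_val :> F -> int;
  pt_val0 : pt_val 0 = 0;
  pt_valM : forall x y, x != 0 -> y != 0 ->
    pt_val (x * y) = pt_val x + pt_val y;
  pt_valD : forall x y, x != 0 -> y != 0 -> x + y != 0 ->
    Num.min (pt_val x) (pt_val y) <= pt_val (x + y);
  pt_valC : forall a, a != 0 -> pt_val (iota a) = 0;
  pt_val1 : exists t, pt_val t = 1 }.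

HB.instance Definition _ := gen_eqMixin place.
HB.instance Definition _ := gen_choiceMixin place.

Lemma place_ext (P Q : place) : P =1 Q -> P = Q.
Proof.
case: P Q => [v ? ? ? ? ?] [w ? ? ? ? ?] /= /funext vw; subst w.
by congr Place; exact: Prop_irrelevance.
Qed.

Definition vge (P : place) (n : int) (x : F) : Prop := x = 0 \/ n <= P x.

(* Divisors; every point has degree 1 since k is algebraically closed, so the
   degree of a divisor is [deg]. *)
Definition divisor := {freeg place / int}.

Definition Lspace (D : divisor) : set F :=
  [set f | f = 0 \/ forall Q : place, 0 <= Q f + coeff Q D].

Definition has_dim (V : set F) (d : nat) : Prop :=
  exists b : 'I_d -> F,
    [/\ forall i, V (b i),
        forall c : 'I_d -> k, \sum_i iota (c i) * b i = 0 -> forall i, c i = 0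
      & forall f, V f -> exists c : 'I_d -> k, f = \sum_i iota (c i) * b i].

(* g = max_D (deg D - dim L(D) + 1). *)
Definition genus (g : nat) : Prop :=
  (forall (D : divisor) (d : nat), has_dim (Lspace D) d ->
     deg D - d%:Z + 1 <= g%:Z) /\
  (exists (D : divisor) (d : nat), has_dim (Lspace D) d /\
     deg D - d%:Z + 1 = g%:Z).

Definition pole_coef (f : F) (Q : place) : int := Num.max 0 (- Q f).

Definition pole_divisor (f : F) (D : divisor) : Prop :=
  forall Q : place, pole_coef f Q = coeff Q D.

Definition pole_number (P : place) (n : nat) : Prop :=
  exists2 f : F, f != 0 & pole_divisor f << n%:Z *g P >>.

(* Aut(X), as the group of k-automorphisms of F.  The automorphism s of F
   sends f to f \o sigma^-1, where sigma is the corresponding automorphism of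
   X, so that composition is preserved; no notion below changes if f \o sigma
   is used instead. *)
Record kaut := KAut {
  kaut_fun :> {rmorphism F -> F};
  kaut_bij : bijective kaut_fun;
  kaut_const : forall a, kaut_fun (iota a) = iota a }.

HB.instance Definition _ := gen_eqMixin kaut.
HB.instance Definition _ := gen_choiceMixin kaut.

Lemma rmorph_ext (u v : {rmorphism F -> F}) : u =1 v -> u = v.
Proof.
case: u v => [u [[u0] [u1]]] [v [[v0] [v1]]] /= /funext uv; subst v.
congr GRing.RMorphism.Pack; congr GRing.RMorphism.Class.
  by congr GRing.isNmodMorphism.Axioms_; exact: Prop_irrelevance.
by congr GRing.isMonoidMorphism.Axioms_; exact: Prop_irrelevance.
Qed.

Lemma kaut_ext (s u : kaut) : s =1 u -> s = u.
Proof.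
case: s u => [s ? ?] [u ? ?] /= /rmorph_ext su; subst u.
by congr KAut; exact: Prop_irrelevance.
Qed.

Definition kaut1 : kaut :=
  @KAut idfun (Bijective (frefl _) (frefl _)) (frefl _).

Lemma kaut_mul_const (s u : kaut) a : (s \o u) (iota a) = iota a.
Proof. by rewrite /= !kaut_const. Qed.

Definition kaut_mul (s u : kaut) : kaut :=
  @KAut (s \o u) (bij_comp (kaut_bij s) (kaut_bij u)) (kaut_mul_const s u).

Lemma kaut_inv_ex (s : kaut) : exists u : kaut, cancel s u /\ cancel u s.
Proof.
case: (kaut_bij s) => u su us.
have uD : nmod_morphism u.
  by split=> [|x y]; apply: (can_inj su); rewrite ?rmorph0 ?rmorphD ?us.
have uM : monoid_morphism u.
  by split=> [|x y]; apply: (can_inj su); rewrite ?rmorph1 ?rmorphM ?us.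
pose uH := GRing.isNmodMorphism.Build F F u uD.
pose uR := GRing.isMonoidMorphism.Build F F u uM.
pose ur : {rmorphism F -> F} :=
  GRing.RMorphism.Pack (GRing.RMorphism.Class uH uR).
have uC a : ur (iota a) = iota a by apply: (can_inj su); rewrite us kaut_const.
by exists (@KAut ur (Bijective us su) uC).
Qed.

Definition kaut_inv (s : kaut) : kaut := projT1 (cid (kaut_inv_ex s)).

Lemma kautK (s : kaut) : cancel s (kaut_inv s).
Proof. by rewrite /kaut_inv; case: cid => u []. Qed.

Lemma kautVK (s : kaut) : cancel (kaut_inv s) s.
Proof. by rewrite /kaut_inv; case: cid => u []. Qed.

Lemma kaut_mulA : associative kaut_mul.
Proof. by move=> s u w; apply: kaut_ext. Qed.

Lemma kaut_mul1 : left_id kaut1 kaut_mul.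
Proof. by move=> s; apply: kaut_ext. Qed.

Lemma kaut_1mul : right_id kaut1 kaut_mul.
Proof. by move=> s; apply: kaut_ext. Qed.

Lemma kaut_mulV : left_inverse kaut1 kaut_inv kaut_mul.
Proof. by move=> s; apply: kaut_ext => x; exact: kautK. Qed.

Lemma kaut_Vmul : right_inverse kaut1 kaut_inv kaut_mul.
Proof. by move=> s; apply: kaut_ext => x; exact: kautVK. Qed.

HB.instance Definition _ :=
  isGroup.Build kaut kaut_mulA kaut_mul1 kaut_1mul kaut_mulV kaut_Vmul.

Lemma kautM (s u : kaut) x : (s * u)%g x = s (u x). Proof. by []. Qed.

Section Action.
Variables (s : kaut) (P : place).
Let v x := P ((s^-1)%g x).

Let v0 : v 0 = 0. Proof. by rewrite /v rmorph0 pt_val0. Qed.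

Let vM x y : x != 0 -> y != 0 -> v (x * y) = v x + v y.
Proof. by move=> x0 y0; rewrite /v rmorphM pt_valM ?fmorph_eq0. Qed.

Let vD x y : x != 0 -> y != 0 -> x + y != 0 -> Num.min (v x) (v y) <= v (x + y).
Proof.
by move=> x0 y0 xy0; rewrite /v rmorphD pt_valD -?rmorphD ?fmorph_eq0.
Qed.

Let vC a : a != 0 -> v (iota a) = 0.
Proof. by move=> a0; rewrite /v kaut_const pt_valC. Qed.

Let v1 : exists t, v t = 1.
Proof. by have [t Pt] := pt_val1 P; exists (s t); rewrite /v kautK. Qed.

(* The point sigma(P). *)
Definition pt_act : place := Place v0 vM vD vC v1.

End Action.

Lemma pt_act1 P : pt_act 1%g P = P.
Proof. by apply: place_ext => x /=; rewrite -{2}[x](kautK 1%g). Qed.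

Lemma pt_actM s u P : pt_act (s * u)%g P = pt_act s (pt_act u P).
Proof.
apply: place_ext => x /=; congr (P _).
by apply: (can_inj (kautK (s * u)%g)); rewrite kautVK kautM !kautVK.
Qed.

Section Decomposition.
Variables (G : set kaut) (P : place) (t : F).

Definition stab : set kaut := [set s | G s /\ pt_act s P = P].

Definition G1 : set kaut := [set s | stab s /\ vge P 2 (s t - t)].

End Decomposition.

Record GL (V : set F) := MkGL {
  gl_fun :> {f : F | V f} -> {f : F | V f};
  gl_linear : forall (a : k) (f g h : {f : F | V f}),
    sval h = iota a * sval f + sval g ->
    sval (gl_fun h) = iota a * sval (gl_fun f) + sval (gl_fun g);
  gl_bij : bijective gl_fun }.

Section Representation.
Variables (P : place) (n : nat).
Let V := Lspace << n%:Z *g P >>.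

Lemma Lspace_stable s f : pt_act s P = P -> V f -> V (s f).
Proof.
move=> sP [->|fV]; [by left; rewrite rmorph0|right=> Q].
have := fV (pt_act (s^-1)%g Q); rewrite !coeffU.
have -> : (P == pt_act (s^-1)%g Q) = (P == Q).
  apply/eqP/eqP=> [PQ|<-]; last by rewrite -{2}sP -pt_actM mulVg pt_act1.
  by rewrite -sP PQ -pt_actM mulgV pt_act1.
by rewrite /= invgK.
Qed.

Lemma stabV s : pt_act s P = P -> pt_act (s^-1)%g P = P.
Proof. by move=> sP; rewrite -{1}sP -pt_actM mulVg pt_act1. Qed.

Section Rep.
Variables (s : kaut) (sP : pt_act s P = P).

Definition rep_fun (f : {f : F | V f}) : {f : F | V f} :=
  exist _ (s (sval f)) (Lspace_stable sP (proj2_sig f)).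

Lemma rep_linear a (f g h : {f : F | V f}) :
  sval h = iota a * sval f + sval g ->
  sval (rep_fun h) = iota a * sval (rep_fun f) + sval (rep_fun g).
Proof. by move=> /= ->; rewrite rmorphD rmorphM kaut_const. Qed.

Lemma rep_bij : bijective rep_fun.
Proof.
exists (fun f => exist _ _ (Lspace_stable (stabV sP) (proj2_sig f))) => -[f Vf].
- by apply: eq_exist => /=; exact: kautK.
- by apply: eq_exist => /=; exact: kautVK.
Qed.

(* The natural representation on L(nP), evaluated at s. *)
Definition rep : GL V := MkGL rep_linear rep_bij.

End Rep.
End Representation.

Section Filtration.
Variables (G : set kaut) (P : place) (t : F) (m : nat -> nat).

(* The kernel of rho_i : G_1(P) -> GL(L(m_i P)); m i is meant to be the i-th
   pole number at P, starting from m 0 = 0. *)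
Definition ker_rho (i : nat) : set kaut :=
  [set s | exists h : G1 G P t s, rep (m i) h.1.2 =1 id].

Definition jump (i : nat) : Prop := ker_rho i.+1 `<` ker_rho i.

(* F_i, the function field of X / ker rho_i. *)
Definition F_ (i : nat) : set F :=
  [set x | forall s, ker_rho i s -> s x = x].

End Filtration.

End Curve.

(* Main.v *)
Require Import Defs.
From HB Require Import structures.
From mathcomp Require Import all_boot all_order all_algebra.
From mathcomp Require Import boolp classical_sets.
From mathcomp Require Import freeg.
From mathcomp Require Import ring zify.

Import Order.TTheory GRing.Theory Num.Theory.
Local Open Scope classical_set_scope.
Local Open Scope ring_scope.

(** An automorphism of [F] in G_1(P) lies in the kernel of rho_i exactly when it
fixes f_0, ..., f_i, because these functions span L(m_i P) over [k]
([Lspace_fixed], [ker_fixes]): subtracting from y in L(m_i P) a constant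
multiple of the f_j with the same pole order at P lowers the pole order, and a
function without poles is constant.  Hence ker rho_(i+1) is the stabilizer of
f_(i+1) in ker rho_i, and since f_(i+1) belongs to F_(i+1), the index i is a
jump if and only if f_(i+1) is not in F_i ([jumpP]); this is also equivalent to
F_i and F_(i+1) being different.

For the generators of the F_i one needs the Galois correspondence above
F_1 = k(f_1).  It is obtained one generator at a time: if H is a group with
fixed field inside a subfield S, and a in S has a finite H-orbit, then the field
fixed by the stabilizer of a is inside S ([fixed_by_stabilizer]).  Indeed x fixed
by that stabilizer is a function of a along the orbit, and the Lagrange
interpolation polynomial of that function has H-invariant coefficients.  Starting
from F_1 = k(f_1) and crossing the jumps one by one, F_(i+1) is contained in any
subfield containing k, f_1 and the f_(j+1) for the jumps j <= i ([Fix_sub]), and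
the last two claims follow ([Fix_adjoin]).

Two facts on curves are used.  The function field has transcendence degree one:
it is algebraic over k(u) for every nonconstant u
([algebraic_over_transcendental]).  This makes orbits finite
([finite_orbit]) and shows that every point has residue field k ([residue]).
And a function f without poles is constant ([global_const]).  The latter comes
from the finiteness of the genus: for D realizing the maximum which defines the
genus, L(D) is finite-dimensional and L(D + P) is nonzero, and both are stable
under multiplication by f. *)

Set Implicit Arguments.
Unset Strict Implicit.
Unset Printing Implicit Defensive.

(** * Subfields as field types, and algebraic elements *)

Section Subfield.
Variables (F : fieldType) (S : divringClosed F).

(** A field structure on the elements of [S], so that the theory of algebraic
elements, stated for a morphism of fields, applies to [S] inside [F]. *)
Definition subfield := {x | x \in S}.
HB.instance Definition _ := SubType.on subfield.
HB.instance Definition _ := Choice.on subfield.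
HB.instance Definition _ := [SubChoice_isSubUnitRing of subfield by <:].
HB.instance Definition _ := [SubNzRing_isSubComNzRing of subfield by <:].
HB.instance Definition _ :=
  [SubComUnitRing_isSubIntegralDomain of subfield by <:].
HB.instance Definition _ := [SubIntegralDomain_isSubField of subfield by <:].

Definition inclusion : {rmorphism subfield -> F} :=
  GRing.RMorphism.clone _ _ (\val : subfield -> F) _.

Lemma algebraic_mem y : y \in S -> algebraicOver inclusion y.
Proof. by move=> yS; exact: algebraic_id (Sub y yS : subfield). Qed.

(** Multiplication by [y] on the spanning family [b] is given by a matrix over the
subfield, and [y] is an eigenvalue of it, hence a root of its characteristic
polynomial. *)
Lemma algebraic_of_span (b : seq F) :
  (forall y : F, exists2 a : nat -> F,
     (forall i, a i \in S) & y = \sum_(i < size b) a i * b`_i) ->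
  forall y, algebraicOver inclusion y.
Proof.
move=> bP y; set n := size b in bP *.
pose v : 'cV[F]_n := \col_i b`_i.
have v_neq0 : v != 0.
  apply/eqP => v0; have [a _] := bP 1; rewrite big1 => [/eqP|i _].
    by rewrite oner_eq0.
  by have /colP/(_ i) := v0; rewrite !mxE => ->; rewrite mulr0.
have rowP_ (i : 'I_n) : exists a : 'rV[subfield]_n,
    y * b`_i = \sum_j inclusion (a 0 j) * b`_j.
  have [a aS ->] := bP (y * b`_i).
  exists (\row_j Sub (a j) (aS j)).
  by apply: eq_bigr => j _; rewrite mxE.
have [A AP] := choice rowP_.
pose M : 'M[subfield]_n := \matrix_(i, j) A i 0 j.
exists (char_poly M^T).
  by rewrite monic_neq0 ?char_poly_monic.
rewrite map_char_poly -eigenvalue_root_char; apply/eigenvalueP.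
exists v^T; last by rewrite trmx_eq0.
rewrite -map_trmx -trmx_mul -linearZ; congr (_^T).
apply/colP => i; rewrite !mxE AP.
by apply: eq_bigr => j _; rewrite !mxE.
Qed.

End Subfield.

(** Replaces polynomials over the type [subfield S] by polynomials over [F] with
coefficients in [S]. *)
Lemma algebraic_polyOver (F : fieldType) (S : divringClosed F) (y : F) :
  algebraicOver (inclusion S) y <->
  exists2 p, p != 0 & p \is a polyOver S /\ root p y.
Proof.
split=> [[p p0 py]|[p p0 [/polyOverP pS py]]].
  exists (map_poly (inclusion S) p); rewrite ?map_poly_eq0 //; split=> //.
  by apply/polyOverP => i; rewrite coef_map; apply: valP.
pose q := \poly_(i < size p) (insubd 0 p`_i : subfield S).
have qE : map_poly (inclusion S) q = p.
  apply/polyP => i; rewrite coef_map coef_poly.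
  case: ltnP => [_|?]; last by rewrite [RHS]nth_default.
  by rewrite /= val_insubd pS.
by exists q; rewrite ?qE // -(map_poly_eq0 (inclusion S)) qE.
Qed.

(** * The subfield k(x) *)

Section Adjoin.
Variables (k : closedFieldType) (F : fieldType) (iota : {rmorphism k -> F}).
Implicit Types (S E : set F) (x y : F).

Lemma sub_adjoin S : S `<=` adjoin iota S.
Proof. by move=> x Sx E _ _; apply. Qed.

Lemma const_adjoin S a : adjoin iota S (iota a).
Proof. by move=> E _ kE _; apply: kE; exists a. Qed.

Lemma adjoin_sub S E : GRing.divring_closed [in E] -> range iota `<=` E ->
  S `<=` E -> adjoin iota S `<=` E.
Proof. by move=> divE kE SE x; apply. Qed.

Lemma adjoin_divring S : GRing.divring_closed [in adjoin iota S].
Proof.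
split=> [|x y /set_mem Sx /set_mem Sy|x y /set_mem Sx /set_mem Sy];
  apply/mem_set => E divE kE SE; have [E1 EB Ediv] := divE; apply: set_mem.
- exact: E1.
- by apply: EB; apply/mem_set; [apply: Sx|apply: Sy].
- by apply: Ediv; apply/mem_set; [apply: Sx|apply: Sy].
Qed.

Definition adjoin_pred S : {pred F} := [in adjoin iota S].
HB.instance Definition _ S :=
  GRing.isDivringClosed.Build F (adjoin_pred S) (@adjoin_divring S).

(** Evaluation of polynomials over [k] at [x]; its image is k[x]. *)
Definition ev x (p : {poly k}) : F := (map_poly iota p).[x].
HB.instance Definition _ x :=
  GRing.RMorphism.copy (ev x) (horner_eval x \o map_poly iota).

Lemma evM x : {morph ev x : p q / p * q}. Proof. exact: rmorphM. Qed.
Lemma evB x : {morph ev x : p q / p - q}. Proof. exact: rmorphB. Qed.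
Lemma ev1 x : ev x 1 = 1. Proof. exact: rmorph1. Qed.

Lemma evX x : ev x 'X = x.
Proof. by rewrite /ev map_polyX hornerX. Qed.

Lemma evC x a : ev x a%:P = iota a.
Proof. by rewrite /ev map_polyC hornerC. Qed.

Lemma ev_eq0 x p : ~ algebraicOver iota x -> (ev x p == 0) = (p == 0).
Proof.
move=> x_tr; apply/eqP/eqP=> [px|->]; last exact: rmorph0.
by apply/eqP/negP => /negP p0; apply: x_tr; exists p => //; apply/eqP.
Qed.

Lemma ev_adjoin x p : adjoin iota [set x] (ev x p).
Proof.
apply/set_mem; rewrite -[_ \in _]/(_ \in adjoin_pred _).
rewrite /ev horner_coef rpred_sum // => i _.
rewrite coef_map rpredM ?rpredX //; apply/mem_set; first exact: const_adjoin.
exact: sub_adjoin.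
Qed.

(** Fractions n(x) / d(x) form a subfield, hence exhaust k(x). *)
Lemma adjoin1_frac x y : adjoin iota [set x] y ->
  exists2 d, ev x d != 0 & exists n, ev x n = ev x d * y.
Proof.
pose E := [set y | exists2 d, ev x d != 0 & exists n, ev x n = ev x d * y].
suff /adjoin_sub EP: GRing.divring_closed [in E].
  apply: EP => [_ [a _ <-]|_ ->].
    by exists 1; rewrite ev1 ?oner_eq0 //; exists a%:P; rewrite evC mul1r.
  by exists 1; rewrite ev1 ?oner_eq0 //; exists 'X; rewrite evX mul1r.
split=> [|u v /set_mem[d d0 [n nE]] /set_mem[e e0 [m mE]]|
         u v /set_mem[d d0 [n nE]] /set_mem[e e0 [m mE]]]; apply/mem_set.
- by exists 1; rewrite ev1 ?oner_eq0 //; exists 1; rewrite ev1 mul1r.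
- exists (d * e); first by rewrite evM mulf_neq0.
  exists (n * e - m * d); rewrite evB !evM nE mE mulrBr.
  by rewrite mulrAC [in X in _ - X]mulrAC [_ * ev x d]mulrC.
- have [v0|v_neq0] := eqVneq v 0.
    exists 1; rewrite ?ev1 ?oner_eq0 //.
    by exists 0; rewrite rmorph0 v0 invr0 !mulr0.
  exists (d * m); first by rewrite evM mE !mulf_neq0.
  by exists (n * e); rewrite !evM nE mE; field.
Qed.

Lemma clear_denominators x (p : {poly F}) :
    p \is a polyOver (adjoin_pred [set x]) ->
  exists2 d, ev x d != 0 & exists q, map_poly (ev x) q = ev x d *: p.
Proof.
elim/poly_ind: p => [_|p c IH /polyOverP pc].
  by exists 1; rewrite ?ev1 ?oner_eq0 //; exists 0; rewrite rmorph0 scaler0.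
have [|d d0 [q qE]] := IH.
  by apply/polyOverP => i; have := pc i.+1; rewrite coefD coefMX coefC addr0.
have := pc 0; rewrite coefD coefMX coefC add0r /= => /set_mem/adjoin1_frac.
case=> e e0 [n nE]; exists (d * e); first by rewrite evM mulf_neq0.
exists (e *: q * 'X + (d * n)%:P).
rewrite rmorphD rmorphM /= map_polyZ map_polyX map_polyC /= !evM qE nE.
rewrite scalerDr scalerAl scalerA; congr (_ + _); first by rewrite [ev x e * _]mulrC.
by rewrite mulrA polyCM mul_polyC.
Qed.

End Adjoin.

(** * Transcendence degree one *)

Section Transcendence.
Variables (k : closedFieldType) (F : fieldType) (iota : {rmorphism k -> F}).
Implicit Types x y u : F.
Local Notation ev := (ev iota).
Local Notation "k( x )" := (adjoin_pred iota [set x]).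

(** A bivariate polynomial can be evaluated at [(x, y)] in either order. *)
Lemma ev_swap x y (q : {poly {poly k}}) :
  (map_poly (ev x) q).[y] = (map_poly (ev y) (swapXY q)).[x].
Proof.
have evE u v r : (map_poly (ev u) r).[v] = (map_poly (map_poly iota) r).[v, u].
  have -> : map_poly (ev u) r =
      map_poly (horner_eval u) (map_poly (map_poly iota) r).
    by rewrite -map_poly_comp.
  by rewrite -[v in LHS](hornerC v u) horner_map.
by rewrite !evE -swapXY_map horner2_swapXY.
Qed.

(** Clearing denominators turns an algebraic equation over k(x) into a polynomial
relation between [x] and [y]. *)
Lemma algebraic_bivariate x y : algebraicOver (inclusion k(x)) y ->
  exists2 q : {poly {poly k}}, q != 0 & root (map_poly (ev x) q) y.
Proof.
move=> /algebraic_polyOver[p p0 [/clear_denominators[d d0 [q qE]] py]].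
exists q; last by rewrite qE rootE hornerZ (rootP py) mulr0.
apply: contraNneq p0 => q0; move/eqP: qE.
by rewrite q0 rmorph0 eq_sym scaler_eq0 (negPf d0).
Qed.

Hypothesis curveF : function_field iota.

(** Exchange argument: for [x] such that [F] is finite over k(x), the relation
between [x] and [u], read as an equation for [x], makes [x] algebraic over k(u);
then k(x), and so everything algebraic over k(x), is algebraic over k(u). *)
Lemma algebraic_over_transcendental u : ~ algebraicOver iota u ->
  forall y, algebraicOver (inclusion k(u)) y.
Proof.
move=> u_tr y; have [x _ [b bP]] := curveF.
have algx z : algebraicOver (inclusion k(x)) z.
  apply: algebraic_of_span (b) _ z => z.
  by have [a aP ->] := bP z; exists a => // i; apply/mem_set.
have algux : algebraicOver (inclusion k(u)) x.
  have [q q0 qu] := algebraic_bivariate (algx u).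
  (* The relation, as a polynomial in x over k[u], stays nonzero because u is
     transcendental. *)
  apply/algebraic_polyOver; exists (map_poly (ev u) (swapXY q)).
    rewrite map_poly_eq0_id0; rewrite ?swapXY_eq0 ?ev_eq0 //.
    by rewrite lead_coef_eq0 swapXY_eq0.
  split; last by rewrite rootE -ev_swap.
  apply/polyOverP => i; rewrite coef_map; apply/mem_set. exact: ev_adjoin.
have [p p0 [pS py]] := (algebraic_polyOver _ _).1 (algx y).
apply/integral_algebraic/(integral_root p0 py) => _ /(nthP 0)[i _ <-].
apply/integral_algebraic; move/polyOverP/(_ i)/set_mem: pS.
suff EP : GRing.divring_closed [in [set z | algebraicOver (inclusion k(u)) z]].
  apply: (adjoin_sub EP) => [_ [a _ <-]|_ ->] //.
  by apply: algebraic_mem; apply: mem_set; exact: const_adjoin.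
split=> [|v w /set_mem va /set_mem wa|v w /set_mem va /set_mem wa];
  apply/mem_set.
- exact: algebraic1.
- exact: algebraic_sub.
- exact: algebraic_div.
Qed.

End Transcendence.

(** * Valuations, residues and spaces L(D) *)

Section Valuation.
Variables (k : closedFieldType) (F : fieldType) (iota : {rmorphism k -> F}).
Implicit Types (x y f h : F) (P Q : place iota) (n : int) (D : divisor iota).

(** A polynomial over the algebraically closed [k] splits, so its roots in [F] are
constants. *)
Lemma algebraic_const x : algebraicOver iota x -> range iota x.
Proof.
case=> p p0; have [r ->] := closed_field_poly_normal p.
rewrite linearZ /= rootZ ?fmorph_eq0 ?lead_coef_eq0 // rmorph_prod /=.
under eq_bigr do rewrite rmorphB /= map_polyX map_polyC /=.
rewrite -(big_map iota xpredT (fun z => 'X - z%:P)) root_prod_XsubC.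
by case/mapP => c _ ->; exists c.
Qed.

Lemma pt_val_1 P : P 1 = 0.
Proof. by rewrite -(rmorph1 iota) pt_valC ?oner_eq0. Qed.

Lemma pt_valN P x : P (- x) = P x.
Proof.
have [->|x0] := eqVneq x 0; first by rewrite oppr0.
rewrite -mulN1r pt_valM ?oppr_eq0 ?oner_eq0 //.
by rewrite -(rmorph1 iota) -rmorphN pt_valC ?add0r // oppr_eq0 oner_eq0.
Qed.

Lemma transcendental_val P x : P x != 0 -> ~ algebraicOver iota x.
Proof.
move=> Px /algebraic_const[c _ cx]; move: Px; rewrite -cx.
have [->|c0] := eqVneq c 0; first by rewrite rmorph0 pt_val0 eqxx.
by rewrite pt_valC ?eqxx.
Qed.

Lemma vge0 P n : vge P n 0. Proof. by left. Qed.

Lemma vge_neq0 P n x : x != 0 -> vge P n x -> n <= P x.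
Proof. by move=> /eqP x0 []. Qed.

Lemma vgeW P m n x : m <= n -> vge P n x -> vge P m x.
Proof. by move=> mn [->|nx]; [left|right; exact: le_trans nx]. Qed.

Lemma vgeD P n x y : vge P n x -> vge P n y -> vge P n (x + y).
Proof.
move=> nx ny; have [->|x0] := eqVneq x 0; first by rewrite add0r.
have [->|y0] := eqVneq y 0; first by rewrite addr0.
have [->|xy0] := eqVneq (x + y) 0; [exact: vge0|right].
apply: le_trans (pt_valD _ x0 y0 xy0).
by rewrite le_min (vge_neq0 x0 nx) (vge_neq0 y0 ny).
Qed.

Lemma vgeN P n x : vge P n x -> vge P n (- x).
Proof. by case=> [->|nx]; [left; rewrite oppr0|right; rewrite pt_valN]. Qed.

Lemma vgeB P n x y : vge P n x -> vge P n y -> vge P n (x - y).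
Proof. by move=> nx ny; apply: vgeD => //; apply: vgeN. Qed.

Lemma vgeM P m n x y : vge P m x -> vge P n y -> vge P (m + n) (x * y).
Proof.
move=> mx ny; have [->|x0] := eqVneq x 0; first by rewrite mul0r; left.
have [->|y0] := eqVneq y 0; first by rewrite mulr0; left.
by right; rewrite pt_valM // lerD ?(vge_neq0 x0 mx) ?(vge_neq0 y0 ny).
Qed.

Lemma vgeC P c : vge P 0 (iota c).
Proof.
have [->|c0] := eqVneq c 0; first by rewrite rmorph0; left.
by right; rewrite pt_valC.
Qed.

Lemma vge_sum (I : Type) (r : seq I) (A : pred I) P n (G : I -> F) :
  (forall i, A i -> vge P n (G i)) -> vge P n (\sum_(i <- r | A i) G i).
Proof. by move=> G_; elim/big_ind: _ => //; [left|apply: vgeD]. Qed.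

Lemma vgeX P n x i : vge P n x -> vge P (n *+ i) (x ^+ i).
Proof.
move=> nx; elim: i => [|i IH]; last by rewrite exprS mulrS; apply: vgeM.
by rewrite expr0 mulr0n; right; rewrite pt_val_1.
Qed.

Lemma vge_ev P x p : vge P 0 x -> vge P 0 (ev iota x p).
Proof.
move=> x_; rewrite /ev horner_coef; apply: vge_sum => i _.
rewrite coef_map -[0]addr0; apply: vgeM; first exact: vgeC.
by rewrite -(mul0rn _ i); apply: vgeX.
Qed.

Lemma vge1_prime P x y :
  vge P 0 x -> vge P 0 y -> vge P 1 (x * y) -> vge P 1 x \/ vge P 1 y.
Proof.
have [->|x0] := eqVneq x 0; first by left; left.
have [->|y0] := eqVneq y 0; first by right; left.
move=> /(vge_neq0 x0) Px /(vge_neq0 y0) Py /(vge_neq0 (mulf_neq0 x0 y0)).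
rewrite pt_valM // => Pxy.
have [?|?] : 1 <= P x \/ 1 <= P y by lia.
  by left; right.
by right; right.
Qed.

Hypothesis curveF : function_field iota.

(** The residue field at [P] is [k]: a uniformizer [t] and [f] satisfy a polynomial
relation which can be taken not divisible by [t]; reducing it modulo [t] gives a
nonzero polynomial over [k] which kills the residue of [f], and it splits. *)
Lemma residue P f : vge P 0 f -> exists c, vge P 1 (f - iota c).
Proof.
move=> f_; have [t Pt] := pt_val1 P.
have t0 : t != 0 by apply: contra_eq_neq Pt => ->; rewrite pt_val0.
have t_tr : ~ algebraicOver iota t by apply: (@transcendental_val P); rewrite Pt.
have [q q0 qf] :=
  algebraic_bivariate (algebraic_over_transcendental curveF t_tr f).
(* q' is the relation, in the variable t, without its factors t. *)
have [n [q' + qE]] := multiplicity_XsubC (swapXY q) 0.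
rewrite swapXY_eq0 q0 /= => q'0.
have q't : (map_poly (ev iota f) q').[t] = 0.
  move: qf; rewrite rootE ev_swap qE subr0 rmorphM rmorphXn /= map_polyX.
  by rewrite hornerM hornerXn mulf_eq0 expf_eq0 (negPf t0) andbF orbF => /eqP.
have c_ : vge P 1 (ev iota f q'.[0]).
  have := q't; rewrite horner_coef; case sz: (size _) => [|n'].
    move/eqP: sz; rewrite size_poly_eq0 => /eqP/polyP/(_ 0).
    by rewrite coef_map coef0 horner_coef0 /= => -> _; left.
  rewrite big_ord_recl expr0 mulr1 coef_map /= -horner_coef0.
  move/(canRL (addrK _)); rewrite sub0r => ->.
  apply/vgeN/vge_sum => i _; rewrite coef_map -[1]add0r.
  apply: vgeM; first exact: vge_ev.
  by apply: (@vgeW P _ (1 *+ i.+1)); [lia|apply: vgeX; right; rewrite Pt].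
move: q'0 c_; rewrite rootE; set c := q'.[0].
have [r ->] := closed_field_poly_normal c; rewrite scaler_eq0 lead_coef_eq0.
case/norP=> c0 _; rewrite /ev linearZ hornerZ rmorph_prod /= horner_prod.
under eq_bigr do rewrite rmorphB /= map_polyX map_polyC hornerXsubC.
move=> cr; have {cr}: vge P 1 (\prod_(z <- r) (f - iota z)).
  have := vgeM (vgeC P (lead_coef c)^-1) cr; rewrite add0r mulrA -rmorphM.
  by rewrite mulVf ?lead_coef_eq0 // rmorph1 mul1r.
have fz z : vge P 0 (f - iota z) by apply: vgeB => //; exact: vgeC.
elim: r => [|z r IH].
  by rewrite big_nil => /(vge_neq0 (oner_neq0 _)); rewrite pt_val_1.
rewrite big_cons => /vge1_prime[//||?|/IH //]; last by exists z.
elim/big_ind: _ => //; first by right; rewrite pt_val_1.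
by move=> x y x_ y_; rewrite -[0]addr0; apply: vgeM.
Qed.

(** Membership in L(D) one point at a time; the junk value at 0 is harmless in this
form. *)
Lemma LspaceP D x : Lspace D x <-> forall Q, vge Q (- coeff Q D) x.
Proof.
split=> [[->|xD] Q|xD]; [by left|right; have := xD Q; lia|].
have [->|x0] := eqVneq x 0; [by left|right=> Q].
by have := vge_neq0 x0 (xD Q); lia.
Qed.

Lemma LspaceM D f x : (forall Q, vge Q 0 f) -> Lspace D x -> Lspace D (f * x).
Proof.
move=> f_ /LspaceP xD; apply/LspaceP => Q; rewrite -[X in vge _ X]add0r.
exact: vgeM.
Qed.

(** In dimension [d], the vectors f^i h with i <= d are linearly dependent, and [h]
can be cancelled from the relation. *)
Lemma stable_algebraic (V : set F) d f h : has_dim iota V d -> h != 0 ->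
  (forall i, V (f ^+ i * h)) -> algebraicOver iota f.
Proof.
case=> b [_ _ bP] h0 fV.
have [A AP] := choice (fun i : 'I_d.+1 => bP _ (fV i)).
pose M := \matrix_(i, j) A i j.
have [u uM u0] : exists2 u : 'rV_d.+1, u *m M = 0 & u != 0.
  exists (nz_row (kermx M)); first by apply/sub_kermxP/nz_row_sub.
  rewrite nz_row_eq0 kermx_eq0 /row_free; apply: contraTneq (rank_leq_col M).
  by move=> ->; rewrite ltnn.
exists (rVpoly u).
  by apply: contra_neq u0 => /(canRL rVpolyK) ->; rewrite linear0.
rewrite rootE -(mulIr_eq0 _ (mulIf h0)) (@horner_coef_wide _ d.+1); last first.
  by rewrite size_map_poly size_poly.
rewrite mulr_suml.
under eq_bigr => i _.
  rewrite coef_map coef_rVpoly_ord -mulrA AP mulr_sumr; over.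
rewrite exchange_big big1 // => j _ /=.
under eq_bigr do rewrite mulrA -rmorphM.
rewrite -mulr_suml -rmorph_sum /=; have /rowP/(_ j) := uM.
rewrite !mxE => uM0; rewrite (eq_bigr (fun i => u 0 i * M i j)) ?uM0.
  by rewrite rmorph0 mul0r.
by move=> i _; rewrite mxE.
Qed.

(** Let D be a divisor for which the maximum defining the genus is reached; L(D) is
then finite-dimensional.  If it is nonzero, multiplication by [f] on L(D) makes
[f] algebraic over [k], hence constant.  If L(D) = 0, then
L(D + P) is nonzero, as otherwise D + P would exceed the genus; for h in it and
c the residue of [f] at P, (f - c) h lies in L(D) = 0. *)
Lemma global_const g P f : genus iota g -> (forall Q, vge Q 0 f) -> range iota f.
Proof.
move=> [le_g [D [d [dimD degDg]]]] f_.
have fX i D' h : Lspace D' h -> Lspace D' (f ^+ i * h).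
  move=> hD; elim: i => [|i IH]; first by rewrite mul1r.
  by rewrite exprS -mulrA; apply: LspaceM.
case: d => [|d] in dimD degDg.
  have D0 x : Lspace D x -> x = 0.
    by have [b [_ _ bP]] := dimD; case/bP => c ->; rewrite big_ord0.
  have [h hD h0] : exists2 h, Lspace (D + << 1 *g P >>) h & h != 0.
    apply: contrapT => noh.
    have: has_dim iota (Lspace (D + << 1 *g P >>)) 0.
      exists (fun=> 0); split=> [[]//|c _ []//|x xD]; exists (fun=> 0).
      rewrite big_ord0; apply/eqP; apply: contrapT => /negP x0.
      by apply: noh; exists x.
    by move/le_g; rewrite degD degU; lia.
  have [c fc] := residue (f_ P).
  exists c => //; apply/esym/eqP; rewrite -subr_eq0.
  have /eqP : (f - iota c) * h = 0.
    apply: D0; apply/LspaceP => Q; move/LspaceP: hD => /(_ Q).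
    rewrite coeffD coeffU; have [PQ|_] := eqVneq P Q; last first.
      rewrite mulr0 addr0 => /(vgeM (vgeB (f_ Q) (vgeC Q c))).
      by rewrite add0r.
    by rewrite -PQ => /(vgeM fc); apply: vgeW; lia.
  by rewrite mulf_eq0 (negPf h0) orbF.
apply: algebraic_const; have [b [bD bfree _]] := dimD.
apply: (stable_algebraic (h := b ord0) dimD) => [|i]; last exact: fX.
apply/eqP => b0; suff /eqP : (1 : k) = 0 by rewrite oner_eq0.
have := bfree (fun i => (i == ord0)%:R) _ ord0; rewrite eqxx; apply.
rewrite (bigD1 ord0) //= b0 mulr0 add0r big1 // => i /negPf->.
by rewrite rmorph0 mul0r.
Qed.

End Valuation.

(** * Fixed fields of stabilizers by Lagrange interpolation *)

Section Interpolation.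
Variables (k : closedFieldType) (F : fieldType) (iota : {rmorphism k -> F}).
Variables (H : set (kaut iota)) (groupH : group_closed [in H]).

Lemma set_group1 : H 1%g.
Proof. by case: groupH => /set_mem. Qed.

Lemma set_groupV s : H s -> H (s^-1)%g.
Proof.
move=> Hs; case: groupH => H1 /(_ _ _ H1 (mem_set Hs))/set_mem.
by rewrite div1g.
Qed.

Lemma set_groupM s u : H s -> H u -> H (s * u)%g.
Proof.
move=> Hs /set_groupV Hu; case: groupH => _.
by move=> /(_ _ _ (mem_set Hs) (mem_set Hu))/set_mem; rewrite invgK.
Qed.

Variables (S : divringClosed F).
Hypothesis fixS : forall y, (forall s, H s -> s y = y) -> y \in S.
Variables (a : F) (O : seq F).
Hypotheses (aS : a \in S) (uniqO : uniq O).
Hypothesis orbitO : forall z, z \in O <-> exists2 s, H s & z = s a.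

Lemma mem_orbit s : H s -> s a \in O.
Proof. by move=> Hs; apply/orbitO; exists s. Qed.

Lemma orbit_id : a \in O.
Proof. exact: mem_orbit set_group1. Qed.

Lemma orbit_perm s : H s -> perm_eq (map s O) O.
Proof.
move=> Hs; apply: uniq_perm => // [|z].
  by rewrite map_inj_uniq //; apply: fmorph_inj.
apply/mapP/idP => [[y /orbitO[u Hu ->] ->]|/orbitO[u Hu ->]].
  by rewrite -kautM mem_orbit //; apply: set_groupM.
exists ((s^-1 * u)%g a); last by rewrite -kautM mulgA mulgV mul1g.
by rewrite mem_orbit //; apply: set_groupM => //; apply: set_groupV.
Qed.

(** The polynomial h = sum_z phi(z) prod_(w != z) (X - w), with z and w in the orbit
of [a], takes the stated value at [a].  An element of [H] permutes the orbit
compatibly with [phi], so it fixes the coefficients of h. *)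
Lemma interpolation_mem (phi : F -> F) :
  (forall s z, H s -> z \in O -> s (phi z) = phi (s z)) ->
  phi a * \prod_(w <- O | w != a) (a - w) \in S.
Proof.
move=> phiP.
pose h := \sum_(z <- O) phi z *: \prod_(w <- O | w != z) ('X - w%:P).
have hS i : h`_i \in S.
  apply: fixS => s Hs; rewrite -[in RHS](_ : map_poly s h = h) ?coef_map //.
  rewrite rmorph_sum /= -[RHS](perm_big _ (orbit_perm Hs)) big_map.
  apply: eq_big_seq => z zO; rewrite map_polyZ /= phiP // rmorph_prod /=.
  congr (_ *: _); rewrite -[RHS](perm_big _ (orbit_perm Hs)) big_map.
  apply: eq_big => [w|w _]; first by rewrite (inj_eq (fmorph_inj s)).
  by rewrite rmorphB /= map_polyX map_polyC.
have <- : h.[a] = phi a * \prod_(w <- O | w != a) (a - w).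
  rewrite horner_sum (bigD1_seq a) ?orbit_id //= [X in _ + X]big1 => [|z za].
    rewrite addr0 hornerZ horner_prod; congr (_ * _).
    by apply: eq_bigr => w _; rewrite hornerXsubC.
  rewrite hornerZ horner_prod (big_rem a orbit_id) /= eq_sym za.
  by rewrite hornerXsubC subrr mul0r mulr0.
by rewrite horner_coef rpred_sum // => i _; rewrite rpredM ?rpredX.
Qed.

(** One step of the Galois correspondence.  As [x] is fixed by the stabilizer of [a],
s(a) |-> s(x) is a well-defined function on the orbit.  Interpolating it, and the
constant function 1 to get rid of the product of the differences, expresses [x]
as a quotient of elements of [S]. *)
Lemma fixed_by_stabilizer x : (forall s, H s -> s a = a -> s x = x) -> x \in S.
Proof.
move=> xP.
pose phi z := if pselect (exists2 s, H s & z = s a) is left e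
              then projT1 (cid2 e) x else 0.
have phiE s : H s -> phi (s a) = s x.
  move=> Hs; rewrite /phi; case: pselect => [e|[]]; last by exists s.
  case: cid2 => u Hu sua /=; apply: (can_inj (kautK (u^-1)%g)).
  rewrite -!kautM mulVg [RHS]xP //; first exact: set_groupM (set_groupV Hu) Hs.
  by rewrite kautM sua -kautM mulVg.
have := @interpolation_mem phi _; have := @interpolation_mem (fun=> 1) _.
set d := \prod_(w <- O | _) _ => d_ phi_.
have d0 : d != 0.
  rewrite prodf_seq_neq0; apply/allP => w _; apply/implyP.
  by rewrite subr_eq0 eq_sym.
have -> : x = phi a * d / (1 * d).
  by rewrite mul1r mulfK //; apply/esym; exact: (phiE _ set_group1).
apply: rpred_div; [apply: phi_|apply: d_] => s z Hs; last by rewrite rmorph1.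
by case/orbitO => u Hu ->; rewrite -kautM !phiE //; exact: set_groupM.
Qed.

End Interpolation.

(** * Finite orbits *)

Lemma roots_finite (F : fieldType) (p : {poly F}) :
  p != 0 -> exists rs : seq F, forall z, root p z -> z \in rs.
Proof.
have [n] := ubnP (size p); elim: n p => // n IH p ltpn p0.
have [[z pz]|noroot] := pselect (exists z, root p z); last first.
  by exists [::] => z pz; case: noroot; exists z.
have [q pE] := factor_theorem _ _ pz; move: p0 ltpn; rewrite pE.
rewrite mulf_eq0 polyXsubC_eq0 orbF => q0; rewrite size_Mmonic ?monicXsubC //.
rewrite size_XsubC addn2 /= ltnS => /IH/(_ q0)[rs rsP].
exists (z :: rs) => w; rewrite rootM root_XsubC inE orbC.
by case/orP => [->//|/rsP->]; rewrite orbT.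
Qed.

Section Subfields.
Variables (k : closedFieldType) (F : fieldType) (iota : {rmorphism k -> F}).

Lemma adjoin_mem (S : divringClosed F) (A : set F) :
    (forall c, iota c \in S) -> (forall x, A x -> x \in S) ->
  forall x, adjoin iota A x -> x \in S.
Proof.
move=> cS AS x; apply: (adjoin_sub (E := [set x | x \in S])) => //.
  split=> [|y z /set_mem yS /set_mem zS|y z /set_mem yS /set_mem zS];
    apply/mem_set => /=; [exact: rpred1|exact: rpredB|exact: rpred_div].
by move=> _ [c _ <-] /=.
Qed.

Lemma range_divring : GRing.divring_closed [in range iota].
Proof.
split=> [|y z /set_mem[a _ <-] /set_mem[b _ <-]|
         y z /set_mem[a _ <-] /set_mem[b _ <-]]; apply/mem_set.
- by exists 1; rewrite ?rmorph1.
- by exists (a - b); rewrite ?rmorphB.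
- by exists (a / b); rewrite ?fmorph_div.
Qed.

Variable H : set (kaut iota).

Lemma fixed_divring :
  GRing.divring_closed [in [set x | forall s, H s -> s x = x]].
Proof.
split=> [|y z /set_mem yH /set_mem zH|y z /set_mem yH /set_mem zH];
  apply/mem_set => s Hs; first exact: rmorph1.
- by rewrite rmorphB yH ?zH.
- by rewrite fmorph_div yH ?zH.
Qed.

Lemma adjoin_fixed (A : set F) :
    (forall x, A x -> forall s, H s -> s x = x) ->
  forall x, adjoin iota A x -> forall s, H s -> s x = x.
Proof.
move=> AH x /(adjoin_sub fixed_divring); apply=> [_ [c _ <-] s _|y /AH//].
exact: kaut_const.
Qed.

(** [H] fixes the coefficients of an equation of [x] over k(A), so the orbit of [x]
consists of roots of this equation. *)
Lemma finite_orbit (A : set F) x : group_closed [in H] ->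
    (forall x, A x -> forall s, H s -> s x = x) ->
    algebraicOver (inclusion (adjoin_pred iota A)) x ->
  exists2 O : seq F, uniq O & forall z, z \in O <-> exists2 s, H s & z = s x.
Proof.
move=> groupH AH /algebraic_polyOver[p p0 [/polyOverP pS px]].
have [rs rsP] := roots_finite p0.
exists (undup [seq z <- rs | `[< exists2 s, H s & z = s x >]]).
  exact: undup_uniq.
move=> z; rewrite mem_undup mem_filter; split=> [/andP[/asboolP//]|zP].
apply/andP; split; first exact/asboolP.
have [s Hs ->] := zP; apply: rsP.
suff <- : map_poly s p = p by rewrite rmorph_root.
apply/polyP => i; rewrite coef_map; apply: (adjoin_fixed AH) => //.
by have := pS i; rewrite in_setE.
Qed.

End Subfields.

(** * The kernels of the representations on L(nP) *)

Section Inertia.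
Variables (k : closedFieldType) (F : fieldType) (iota : {rmorphism k -> F}).
Variables (G : set (kaut iota)) (P : place iota) (t : F) (m : nat -> nat).
Hypothesis groupG : group_closed [in G].

Lemma stab_val s x : pt_act s P = P -> P (s x) = P x.
Proof. by move=> sP; rewrite -[in LHS]sP /= kautK. Qed.

Lemma stab_vge s n x : pt_act s P = P -> vge P n x -> vge P n (s x).
Proof. by move=> sP [->|nx]; [left; rewrite rmorph0|right; rewrite stab_val]. Qed.

Lemma G1_group : group_closed [in G1 G P t].
Proof.
split.
  apply/mem_set; split; last by left; rewrite subrr.
  by split; [exact: set_group1 groupG|exact: pt_act1].
move=> s u /set_mem[[Gs sP] st] /set_mem[[Gu uP] ut]; apply/mem_set.
have uVP : pt_act (u^-1)%g P = P by rewrite stabV.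
split; first split.
- exact: (set_groupM groupG Gs (set_groupV groupG Gu)).
- by rewrite pt_actM uVP.
have -> : (s * u^-1)%g t - t = (s t - t) - s ((u^-1)%g (u t - t)).
  by rewrite !rmorphB -[(u^-1)%g (u t)]kautM mulVg kautM /=; ring.
by apply: vgeB => //; do 2!apply: stab_vge => //.
Qed.

Lemma ker_rhoE i s : ker_rho G P t m i s <->
  G1 G P t s /\ forall y, Lspace << (m i)%:Z *g P >> y -> s y = y.
Proof.
split=> [[h hP]|[h hP]].
  by split=> // y yV; have := congr1 sval (hP (exist _ y yV)).
by exists h => -[y yV]; apply: eq_exist; apply: hP.
Qed.

Lemma ker_rho_group i : group_closed [in ker_rho G P t m i].
Proof.
split.
  by apply/mem_set/ker_rhoE; split=> [|y _]; [exact: set_group1 G1_group|].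
move=> s u /set_mem/ker_rhoE[Gs sy] /set_mem/ker_rhoE[Gu uy].
apply/mem_set/ker_rhoE.
split=> [|y yV]; first exact: (set_groupM G1_group Gs (set_groupV G1_group Gu)).
by rewrite kautM -[in LHS](uy y yV) -[(u^-1)%g _]kautM mulVg; apply: sy.
Qed.

End Inertia.

(** * The representation filtration *)

Section Filtration.
Variables (k : closedFieldType) (F : fieldType) (iota : {rmorphism k -> F}).
Hypothesis curveF : function_field iota.
Variables (g : nat) (G : set (kaut iota)) (P : place iota) (t : F).
Hypotheses (genus_g : genus iota g) (groupG : group_closed [in G]).
Variables (r : nat) (m : nat -> nat) (f : nat -> F).
Hypothesis m0 : m 0%N = 0%N.
Hypothesis m_incr : forall i : nat, (i < r)%N -> (m i < m i.+1)%N.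
Hypothesis m_poles : forall n : nat,
  (pole_number P n /\ (n <= m r)%N) <-> (exists2 i, (i <= r)%N & m i = n).
Hypothesis f_neq0 : forall i : nat, (i <= r)%N -> f i != 0.
Hypothesis f_poles : forall i : nat, (i <= r)%N ->
  pole_divisor (f i) << (m i)%:Z *g P >>.
Hypothesis F1_eq : F_ G P t m 1 = adjoin iota [set f 1%N].
Local Notation ker := (ker_rho G P t m).
Local Notation jump := (jump G P t m).
Local Notation Fix := (F_ G P t m).

Lemma m_homo i j : (i < j)%N -> (j <= r)%N -> (m i < m j)%N.
Proof.
elim: j => // j IH; rewrite ltnS leq_eqVlt => /predU1P[->|ij] jr.
  exact: m_incr.
exact: ltn_trans (IH ij (ltnW jr)) (m_incr jr).
Qed.

Lemma m_mono i j : (i <= j)%N -> (j <= r)%N -> (m i <= m j)%N.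
Proof.
by rewrite leq_eqVlt => /predU1P[->//|ij] jr; rewrite ltnW ?m_homo.
Qed.

Lemma f_val i : (0 < i)%N -> (i <= r)%N -> P (f i) = - (m i)%:Z.
Proof.
move=> i0 ir; have := f_poles ir P; have := m_homo i0 ir.
by rewrite /pole_coef coeffU eqxx m0; lia.
Qed.

Lemma f_Lspace i v : (v <= i)%N -> (i <= r)%N ->
  Lspace << (m i)%:Z *g P >> (f v).
Proof.
move=> vi ir; right=> Q; have := f_poles (leq_trans vi ir) Q.
rewrite /pole_coef !coeffU; have := m_mono vi ir.
by case: (P == Q); lia.
Qed.

(** [f 1] has a pole at [P]. *)
Lemma f1_transcendental : (0 < r)%N -> ~ algebraicOver iota (f 1%N).
Proof.
move=> r0; apply: (@transcendental_val _ _ _ P); rewrite f_val //.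
by have := m_homo (ltn0Sn 0) r0; lia.
Qed.

(** Induction on a bound [n] for the pole order of [y] at [P].  If the order is
[n] > 0, then [n] = m_j for some j <= i, as y has no other pole, and y - c f_j has smaller
order for c the residue of y / f_j at [P]. *)
Lemma Lspace_fixed i (s : kaut iota) y : (i <= r)%N ->
  (forall v, (v <= i)%N -> s (f v) = f v) ->
  Lspace << (m i)%:Z *g P >> y -> s y = y.
Proof.
move=> ir sf; suff yP n : forall y, Lspace << (m i)%:Z *g P >> y ->
    vge P (- n%:Z) y -> s y = y.
  move=> yV; apply: (yP (m i)) => //; move/LspaceP: yV => /(_ P).
  by rewrite coeffU eqxx; apply: vgeW; lia.
elim: n => {y} [|n IH] y yV Py.
  suff [c _ <-] : range iota y by exact: kaut_const.
  apply: (global_const curveF P genus_g) => Q.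
  have [<-|PQ] := eqVneq P Q; first by apply: vgeW Py.
  by move/LspaceP: yV => /(_ Q); rewrite coeffU (negPf PQ); apply: vgeW; lia.
have [->|y0] := eqVneq y 0; first exact: rmorph0.
have := vge_neq0 y0 Py; rewrite le_eqVlt => /predU1P[yn|]; last first.
  by move=> yn; apply: IH => //; right; lia.
have [j ji mj] : exists2 j, (j <= i)%N & m j = n.+1.
  have nm : (n.+1 <= m i)%N.
    by move/LspaceP: yV => /(_ P)/(vge_neq0 y0); rewrite coeffU eqxx; lia.
  have [|j jr mj] := (m_poles n.+1).1.
    split; last exact: leq_trans nm (m_mono ir (leqnn r)).
    exists y => // Q; rewrite /pole_coef coeffU.
    move/LspaceP: yV => /(_ Q)/(vge_neq0 y0); rewrite coeffU.
    by have [<-|_] := eqVneq P Q; lia.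
  exists j => //; rewrite leqNgt; apply/negP => ij.
  by have := m_homo ij jr; lia.
have j0 : (0 < j)%N by case: j mj {ji} => //; rewrite m0.
have fj0 : f j != 0 by rewrite f_neq0 // (leq_trans ji).
have Pfj := f_val j0 (leq_trans ji ir).
have Pfj1 : P (f j)^-1 = n.+1%:Z.
  have := pt_valM P fj0 (invr_neq0 fj0).
  by rewrite mulfV // pt_val_1 Pfj; lia.
have [|c yc] := residue curveF (P := P) (f := y / f j).
  by right; rewrite pt_valM ?invr_neq0 // Pfj1; lia.
have zE : y - iota c * f j = (y / f j - iota c) * f j.
  by rewrite mulrBl divfK.
have zs : s (y - iota c * f j) = y - iota c * f j.
  apply: IH; last first.
    rewrite zE; apply: (@vgeW _ _ _ P _ (1 + - n.+1%:Z)); first by lia.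
    by apply: vgeM => //; right; rewrite Pfj mj.
  have cfV : Lspace << (m i)%:Z *g P >> (iota c * f j).
    by apply: LspaceM (f_Lspace ji ir) => Q; exact: vgeC.
  apply/LspaceP => Q; move/LspaceP: yV => /(_ Q) yQ; move/LspaceP: cfV => /(_ Q).
  exact: vgeB yQ.
by move: zs; rewrite rmorphB rmorphM kaut_const sf //; apply: addIr.
Qed.

(** f_0, ..., f_i lie in L(m_i P), and fixing them is enough by [Lspace_fixed]. *)
Lemma ker_fixes i (s : kaut iota) : (i <= r)%N ->
  ker i s <-> G1 G P t s /\ forall v, (v <= i)%N -> s (f v) = f v.
Proof.
move=> ir; rewrite ker_rhoE; split=> [[sG sV]|[sG sf]]; split=> //.
  by move=> v vi; apply/sV/f_Lspace.
by move=> y; apply: Lspace_fixed.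
Qed.

Lemma ker_rhoS i (s : kaut iota) : (i < r)%N ->
  ker i.+1 s <-> ker i s /\ s (f i.+1) = f i.+1.
Proof.
move=> ir; rewrite (ker_fixes s ir) (ker_fixes s (ltnW ir)).
split=> [[sG sf]|[[sG sf] sfi]].
  by split; [split=> // v vi; apply/sf/ltnW|apply: sf].
by split=> // v; rewrite leq_eqVlt => /predU1P[->//|]; exact: sf.
Qed.

Lemma f_fixed i v : (v <= i)%N -> (i <= r)%N -> Fix i (f v).
Proof. by move=> vi ir s /(ker_fixes _ ir)[_]; apply. Qed.

(** [f i.+1] lies in F_(i+1), and ker rho_(i+1) is its stabilizer in ker rho_i. *)
Lemma jumpP i : (i < r)%N -> jump i <-> ~ Fix i (f i.+1).
Proof.
move=> ir; split=> [[_ nker] fi|nfix].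
  by apply: nker => s si; apply/ker_rhoS => //; split=> //; apply: fi.
split=> [s /(ker_rhoS _ ir)[] //|sub]; apply: nfix => s /sub.
by case/(ker_rhoS _ ir).
Qed.

Lemma ker_not_jump i s : (i < r)%N -> ~ jump i -> ker i s -> ker i.+1 s.
Proof.
move=> ir /(jumpP ir)/contrapT fi si.
by apply/ker_rhoS => //; split=> //; apply: fi.
Qed.

(** Induction on [i], starting from F_1 = k(f_1).  If [i] is not a jump then
F_(i+1) = F_i; if it is one, ker rho_(i+1) is the stabilizer of f_(i+1) in ker rho_i and
[fixed_by_stabilizer] applies. *)
Lemma Fix_sub (S : divringClosed F) i : (forall c, iota c \in S) ->
    f 1%N \in S -> (i < r)%N ->
    (forall j, (j <= i)%N -> jump j -> f j.+1 \in S) ->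
  forall x, Fix i.+1 x -> x \in S.
Proof.
move=> cS f1S; elim: i => [|i IH] ir fS x.
  by rewrite F1_eq; apply: adjoin_mem => // _ ->.
have {}IH := IH (ltnW ir) (fun j ji => fS j (leqW ji)).
have [ji|nji] := pselect (jump i.+1); last first.
  by move=> xi; apply: IH => s si; apply: xi; apply: ker_not_jump.
move=> xi; have f1_fixed z : [set f 1%N] z -> forall s, ker i.+1 s -> s z = z.
  by move=> -> s; apply: f_fixed => //; exact: ltnW.
have groupK : group_closed [in ker i.+1] by exact: ker_rho_group.
have f1_tr := f1_transcendental (leq_ltn_trans (leq0n _) ir).
have [O uniqO OP] := finite_orbit groupK f1_fixed
  (algebraic_over_transcendental curveF f1_tr (f i.+2)).
apply: (fixed_by_stabilizer groupK IH (fS _ (leqnn _) ji) uniqO OP) => s si sf.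
by apply: xi; apply/ker_rhoS.
Qed.

Lemma Fix_adjoin (A : set F) i : (i < r)%N -> A (f 1%N) ->
    (forall j, (j <= i)%N -> jump j -> A (f j.+1)) ->
    (forall x, A x -> Fix i.+1 x) ->
  Fix i.+1 = adjoin iota A.
Proof.
move=> ir Af1 Aj AF; apply/seteqP; split=> x; last exact: adjoin_fixed.
move=> xF; suff : x \in adjoin_pred iota A by rewrite in_setE.
apply: (Fix_sub (S := adjoin_pred iota A) _ _ ir) xF => [c||j ji jj];
  apply: mem_set; first exact: const_adjoin.
- exact: sub_adjoin.
- by apply: sub_adjoin; apply: Aj.
Qed.

End Filtration.

Unset Implicit Arguments.

Theorem proposition22
  (k : closedFieldType) (p : nat) (char_k : p \in [pchar k])
  (F : fieldType) (iota : {rmorphism k -> F}) (curveF : function_field iota)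
  (g : nat) (genus_g : genus iota g) (g_ge2 : (2 <= g)%N)
  (G : set (kaut iota)) (subgroup_G : group_closed [in G])
  (P : place iota) (t : F) (uniformizer_t : P t = 1)
  (r : nat) (m : nat -> nat)
  (m0 : m 0%N = 0%N)
  (m_incr : forall i : nat, (i < r)%N -> (m i < m i.+1)%N)
  (m_poles : forall n : nat,
     (pole_number P n /\ (n <= m r)%N) <-> (exists2 i, (i <= r)%N & m i = n))
  (mr_gt1 : (1 < m r)%N) (mr_le : (m r <= 2 * g - 1)%N)
  (mr_pole : pole_number P (m r)) (mr_ndvd : ~~ (p %| m r)%N)
  (mr_min : forall n : nat, pole_number P n -> ~~ (p %| n)%N -> (m r <= n)%N)
  (f : nat -> F)
  (f_neq0 : forall i : nat, (i <= r)%N -> f i != 0)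
  (f_poles : forall i : nat, (i <= r)%N ->
     pole_divisor (f i) << (m i)%:Z *g P >>)
  (X1_rational : rational iota (F_ G P t m 1))
  (F1_eq : F_ G P t m 1 = adjoin iota [set f 1%N]) :
  [/\ forall i : nat, (i < r)%N ->
         jump G P t m i <-> F_ G P t m i <> F_ G P t m i.+1,
      forall js : seq nat, sorted ltn js ->
        (forall i : nat, i \in js <-> (i < r)%N /\ jump G P t m i) ->
        forall l : nat, (l < size js)%N ->
          F_ G P t m (nth 0%N js l).+1 =
          adjoin iota ([set f 0%N; f 1%N] `|`
                       [set f j.+1 | j in [set` take l.+1 js]])
    & forall i : nat, (i < r)%N ->
        (i = 0%N \/ jump G P t m i) <->
        ~ adjoin iota [set f v | v in [set v | (v < i.+1)%N]] (f i.+1)].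
Proof.
have fF i v : (v <= i)%N -> (i <= r)%N -> F_ G P t m i (f v).
  exact: (f_fixed curveF genus_g m0 m_incr m_poles f_neq0 f_poles).
have jumpE i : (i < r)%N -> jump G P t m i <-> ~ F_ G P t m i (f i.+1).
  exact: (jumpP curveF G t genus_g m0 m_incr m_poles f_neq0 f_poles).
have F_adj := Fix_adjoin curveF genus_g subgroup_G m0 m_incr m_poles f_neq0 f_poles
  F1_eq.
split.
- move=> i ir; split=> [/(jumpE i ir) nfi FF|FF].
    by apply: nfi; rewrite FF; apply: fF.
  apply: contrapT => nji; apply: FF; apply/seteqP; split=> x xF s si; apply: xF.
    have kerS := ker_rhoS curveF G t genus_g m0 m_incr m_poles f_neq0 f_poles.
    by have [] := (kerS i s ir).1 si.
  exact: (ker_not_jump curveF genus_g m0 m_incr m_poles f_neq0 f_poles ir nji).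
- move=> js js_sorted jsP l ljs; set i := nth 0%N js l.
  have ijs : i \in js by exact: mem_nth.
  have [ir _] := (jsP i).1 ijs.
  (* As js is sorted, its first l + 1 entries are the jumps up to i = js_l. *)
  have js_take j : j \in take l.+1 js <-> j \in js /\ (j <= i)%N.
    have nth_mono := sorted_ltn_nth ltn_trans 0%N js_sorted.
    split=> [jt|[jjs ji]].
      have jjs := mem_take jt; split=> //; move: jt; rewrite in_take // ltnS.
      rewrite leq_eqVlt => /predU1P[jl|jl]; first by rewrite /i -jl nth_index.
      by rewrite -(nth_index 0%N jjs) ltnW // nth_mono // inE index_mem.
    rewrite in_take // ltnS leqNgt; apply: contraL ji => lj.
    by rewrite -ltnNge -(nth_index 0%N jjs) nth_mono // inE index_mem.
  apply: F_adj => // [|j ji jj|x].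
  + by left; right.
  + right; exists j => //=; apply/js_take; split=> //.
    by apply/jsP; split=> //; apply: leq_ltn_trans ir.
  + case=> [[->|->]|[j /= /js_take[_ ji] <-]]; exact: fF.
- case=> [|i] ir.
    split=> [_ f1|_]; last by left.
    (* For i = 0: f_0 has no poles, so k(f_0) = k does not contain f_1. *)
    apply: (f1_transcendental m0 m_incr f_poles ir).
    have [c _ <-] : range iota (f 1%N); last exact: algebraic_id.
    apply: (adjoin_sub (@range_divring _ _ iota) _ _ f1) => // _ [v /= + <-].
    rewrite ltnS leqn0 => /eqP->; apply: (global_const curveF P genus_g) => Q.
    have := f_poles 0%N isT Q; rewrite /pole_coef coeffU m0 mul0r => fQ.
    by right; lia.
  have FE : F_ G P t m i.+1 = adjoin iota [set f v | v in [set v | (v < i.+2)%N]].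
    apply: F_adj => [||j ji _|_ [v vi <-]]; first exact: ltnW.
    + by exists 1%N.
    + by exists j.+1.
    + by apply: fF; last exact: ltnW.
  rewrite -FE -(jumpE _ ir); split=> [[]//|]; by right.
Qed.
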